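(* Let $n\ge1$ and let $p\approx q$ be an identity in the signature of four binary operations $\lambda,\rho,\tilde\lambda,\tilde\rho$. If $p\approx q$ holds in every finite injective solution belonging to $\mathcal{RNS}_n$, then $p\approx q$ holds in every injective solution belonging to $\mathcal{RNS}_n$ (in particular in the free injective solution in $\mathcal{RNS}_n$ on any non-empty set).
   Context: A solution is a pair $(X,r)$ with $X$ a non-empty set and $r\colon X^2\to X^2$ a bijection with $(r\times\mathrm{id})(\mathrm{id}\times r)(r\times\mathrm{id})=(\mathrm{id}\times r)(r\times\mathrm{id})(\mathrm{id}\times r)$, such that, writing $r(x,y)=(\lambda_x(y),\rho_y(x))$, all $\lambda_x,\rho_x$ are bijective. It is regarded as an algebra with four binary operations $\lambda(x,y)=\lambda_x(y)$, $\rho(x,y)=\rho_y(x)$, $\tilde\lambda(x,y)=\lambda_x^{-1}(y)$, $\tilde\rho(x,y)=\rho_y^{-1}(x)$. An identity (law) $p\approx q$ is a pair of terms in these operations over a set of variables; it holds in $(X,r)$ if $p$ and $q$ take equal values under every assignment of the variables in $X$. The structure group of $(X,r)$ is $G(X,r)=\langle X\mid x\circ y=u\circ v\text{ whenever } r(x,y)=(u,v)\rangle$; $(X,r)$ is injective if the canonical map $X\to G(X,r)$ is injective. The free injective solution in $\mathcal{RNS}_n$ on $Y$ is the free object on $Y$ in the category of injective solutions belonging to $\mathcal{RNS}_n$ (morphisms: maps $f$ with $(f\times f)r=s(f\times f)$). Definition of $\mathcal{RNS}_n$ (right nilpotent solutions of class at most $n$): for a solution $(X,r)$ let $W(X)$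 be the submonoid of $X^X$ generated by all $\lambda_x^{\pm1},\rho_x^{\pm1}$ ($x\in X$) and all maps $D_z\colon X\to X$, $D_z(x)=\rho_x(z)$ ($z\in X$); write $m\cdot x$ for the action of $m\in W(X)$ on $x$. For $k\ge1$, $\alpha\in\{\pm1\}^k$, $v\in X^k$, $m=(m_2,\dots,m_k)\in W(X)^{k-1}$, define $\lambda^{\alpha}_{m,v}\colon X\to X$ recursively: for $k=1$ it is $\lambda_{v_1}^{\alpha_1}$; for $k>1$ it is $\lambda_{z}^{\alpha_k}$ with $z=m_k\cdot\lambda^{(\alpha_1,\dots,\alpha_{k-1})}_{(m_2,\dots,m_{k-1}),(v_1,\dots,v_{k-1})}(v_k)$. The solution belongs to $\mathcal{RNS}_1$ if $\lambda_x=\mathrm{id}$ for all $x$; for $n>1$ it belongs to $\mathcal{RNS}_n$ if $\lambda^{(\alpha_1,\dots,\alpha_n)}_{(m_2,\dots,m_n),(v_1,\dots,v_n)}=\lambda^{(\alpha_2,\dots,\alpha_n)}_{(m_3,\dots,m_n),(m_2\cdot v_2,v_3,\dots,v_n)}$ for all $\alpha\in\{\pm1\}^n$, $m\in W(X)^{n-1}$, $v\in X^n$. *)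

(* Defs.v *)
From mathcomp Require Import all_boot.
From mathcomp Require Import boolp.

Set Implicit Arguments.
Unset Strict Implicit.
Unset Printing Implicit Defensive.

Section Maps.
Variables (X : Type) (r : X * X -> X * X).

Definition r_id (t : X * X * X) : X * X * X :=
  let: (x, y, z) := t in let: (u, v) := r (x, y) in (u, v, z).

Definition id_r (t : X * X * X) : X * X * X :=
  let: (x, y, z) := t in let: (u, v) := r (y, z) in (x, u, v).

(* r (x, y) = (lam_of x y, rho_of y x): the subscript is the first argument
   in both cases. *)
Definition lam_of (x y : X) : X := (r (x, y)).1.
Definition rho_of (y x : X) : X := (r (x, y)).2.
End Maps.

Record solution (X : Type) := Solution {
  sol_map :> X * X -> X * X;
  sol_nonempty : inhabited X;
  sol_bij : bijective sol_map;
  sol_braid : r_id sol_map \o id_r sol_map \o r_id sol_map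
              =1 id_r sol_map \o r_id sol_map \o id_r sol_map;
  sol_lam_bij : forall x, bijective (lam_of sol_map x);
  sol_rho_bij : forall x, bijective (rho_of sol_map x)
}.

Lemma bijective_inverse_ex (A B : Type) (f : A -> B) :
  bijective f -> exists g : B -> A, cancel f g /\ cancel g f.
Proof. by case=> g fK gK; exists g. Qed.

Definition bij_inv (A B : Type) (f : A -> B) (bf : bijective f) : B -> A :=
  sval (cid (bijective_inverse_ex bf)).

Lemma bij_invK (A B : Type) (f : A -> B) (bf : bijective f) :
  cancel f (bij_inv bf).
Proof. exact: proj1 (svalP (cid (bijective_inverse_ex bf))). Qed.

Lemma bij_invVK (A B : Type) (f : A -> B) (bf : bijective f) :
  cancel (bij_inv bf) f.
Proof. exact: proj2 (svalP (cid (bijective_inverse_ex bf))). Qed.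

Section Operations.
Variables (X : Type) (S : solution X).

Definition lam (x : X) : X -> X := lam_of S x.
Definition rho (x : X) : X -> X := rho_of S x.
Definition lamV (x : X) : X -> X := bij_inv (sol_lam_bij S x).
Definition rhoV (x : X) : X -> X := bij_inv (sol_rho_bij S x).

Lemma lamK x : cancel (lam x) (lamV x). Proof. exact: bij_invK. Qed.
Lemma lamVK x : cancel (lamV x) (lam x). Proof. exact: bij_invVK. Qed.
Lemma rhoK x : cancel (rho x) (rhoV x). Proof. exact: bij_invK. Qed.
Lemma rhoVK x : cancel (rhoV x) (rho x). Proof. exact: bij_invVK. Qed.
End Operations.

Definition sol_morphism (X Y : Type) (S : solution X) (T : solution Y)
    (f : X -> Y) : Prop :=
  forall x y, T (f x, f y) = (f (S (x, y)).1, f (S (x, y)).2).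

Inductive term (V : Type) : Type :=
| Var of V
| Lam of term V & term V
| Rho of term V & term V
| LamV of term V & term V
| RhoV of term V & term V.

(* The binary operations rho(x, y) = rho_y(x) and its tilde version act on
   their first argument. *)
Fixpoint eval (X : Type) (S : solution X) (V : Type) (e : V -> X)
    (t : term V) : X :=
  match t with
  | Var v => e v
  | Lam a b => lam S (eval S e a) (eval S e b)
  | Rho a b => rho S (eval S e b) (eval S e a)
  | LamV a b => lamV S (eval S e a) (eval S e b)
  | RhoV a b => rhoV S (eval S e b) (eval S e a)
  end.

Definition holds_in (X : Type) (S : solution X) (V : Type) (p q : term V)
    : Prop :=
  forall e : V -> X, eval S e p = eval S e q.

(* The group presented by the generators X and the relations x y = u v for
   S (x, y) = (u, v): group words modulo the least congruence [sg_eq]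
   containing the group axioms and the defining relations. *)
Inductive group_word (X : Type) : Type :=
| Gen of X
| GOne
| GMul of group_word X & group_word X
| GInv of group_word X.
Arguments GOne {X}.

Inductive sg_eq (X : Type) (S : solution X)
    : group_word X -> group_word X -> Prop :=
| sg_refl a : sg_eq S a a
| sg_sym a b : sg_eq S a b -> sg_eq S b a
| sg_trans a b c : sg_eq S a b -> sg_eq S b c -> sg_eq S a c
| sg_mul a a' b b' :
    sg_eq S a a' -> sg_eq S b b' -> sg_eq S (GMul a b) (GMul a' b')
| sg_inv a a' : sg_eq S a a' -> sg_eq S (GInv a) (GInv a')
| sg_mulA a b c : sg_eq S (GMul a (GMul b c)) (GMul (GMul a b) c)
| sg_mul1g a : sg_eq S (GMul GOne a) a
| sg_mulg1 a : sg_eq S (GMul a GOne) a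
| sg_mulVg a : sg_eq S (GMul (GInv a) a) GOne
| sg_mulgV a : sg_eq S (GMul a (GInv a)) GOne
| sg_rel x y u v : S (x, y) = (u, v) ->
    sg_eq S (GMul (Gen x) (Gen y)) (GMul (Gen u) (Gen v)).

Definition injective_solution (X : Type) (S : solution X) : Prop :=
  forall x y : X, sg_eq S (Gen x) (Gen y) -> x = y.

Section RightNilpotent.
Variables (X : Type) (S : solution X).

Inductive in_W : (X -> X) -> Prop :=
| W_lam x : in_W (lam S x)
| W_lamV x : in_W (lamV S x)
| W_rho x : in_W (rho S x)
| W_rhoV x : in_W (rhoV S x)
| W_D z : in_W (fun x => rho S x z)
| W_id : in_W id
| W_comp f g : in_W f -> in_W g -> in_W (f \o g).

Definition W : Type := {m : X -> X | in_W m}.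

(* Exponents in {1, -1} are booleans, [true] standing for -1. *)
Definition lam_pow (a : bool) (x : X) : X -> X :=
  if a then lamV S x else lam S x.

(* The data (alpha, m, v) in {1, -1}^k * W^(k-1) * X^k is given by alpha_1,
   v_1 and the list [:: (m_2, alpha_2, v_2); ...; (m_k, alpha_k, v_k)]. *)
Definition lam_multi (a1 : bool) (v1 : X) (s : seq (W * bool * X)) : X -> X :=
  foldl (fun (f : X -> X) '(m, a, v) => lam_pow a (sval m (f v)))
        (lam_pow a1 v1) s.

(* The case n = 0 is a dummy: classes start at 1. *)
Definition RNS (n : nat) : Prop :=
  match n with
  | 0 => False
  | 1 => forall x, lam S x =1 id
  | k.+2 => forall (a1 a2 : bool) (v1 v2 : X) (m2 : W)
                   (s : k.-tuple (W * bool * X)),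
      lam_multi a1 v1 ((m2, a2, v2) :: s) =1 lam_multi a2 (sval m2 v2) s
  end.
End RightNilpotent.

Definition is_free_injective_RNS (n : nat) (Y F : Type) (S : solution F)
    (i : Y -> F) : Prop :=
  [/\ injective_solution S, RNS S n &
      forall (X : Type) (T : solution X), injective_solution T -> RNS T n ->
      forall f : Y -> X,
        exists2 g : F -> X, sol_morphism S T g /\ g \o i =1 f
          & forall g' : F -> X,
              sol_morphism S T g' -> g' \o i =1 f -> g' =1 g].

(* Main.v *)
(* Write x ~ y if lambda_(m x) = lambda_(m y) for all m in W(X). If X is in
   RNS_n, the quotient X' = X / ~ is a solution in RNS_(n-1), and the action
   lambda of the structure group G(X) on X factors through G(X'). X' need not be
   injective, but it inherits from X that x |-> lambda_x^-1(x) and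
   x |-> rho_x^-1(x) are mutually inverse, which makes every right addition
   h |-> h + x = h . lambda_h^-1(x) a bijection of G(X) and suffices for the
   induction.

   By induction on n, finitely many words in the terms can be separated in G(X)
   by a finite braided group B. A word w is, additively, a sum of letters
   +- g . y with g a word and y a variable, so w is the endpoint of a walk in
   G(X) starting from 1. By induction there is a finite braided group B' that
   separates the occurring words g up to their action on X; hence the value v of
   g in B' and y determine the bijection h |-> h + g . y. As in M. Hall's proof
   that free groups are residually finite, its restriction to the finite set D of
   points visited by the walks extends to a permutation f_y(v) of D. In the
   wreath product B of Sym(D) with B', where y is assigned (f_y, y'), the first
   component of w at 1 maps 1 to w, so B separates the words in question. B is a
   finite injective solution in RNS_n. *)
Require Import Defs.
From HB Require Import structures.
From mathcomp Require Import all_boot all_fingroup.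
From mathcomp Require Import boolp.

Set Implicit Arguments.
Unset Strict Implicit.
Unset Printing Implicit Defensive.

Local Open Scope quotient_scope.

(** * Solutions and their right nilpotent quotients *)

Section SolutionTheory.
Variables (X : Type) (S : solution X).
Implicit Types (x y z u : X).

Lemma sol_mapE x y : S (x, y) = (lam S x y, rho S y x).
Proof. by rewrite /lam /rho /lam_of /rho_of; case: (S _). Qed.

(** The first component of the braid relation: lambda respects the defining relations of the
    structure group and so becomes an action of it. *)
Lemma lam_lam x y z :
  lam S x (lam S y z) = lam S (lam S x y) (lam S (rho S y x) z).
Proof.
have := sol_braid S (x, y, z); rewrite /= /r_id /id_r.
by do 6! rewrite sol_mapE /=; case.
Qed.

Lemma rho_lam x y z :
  rho S (lam S (rho S y x) z) (lam S x y)
  = lam S (rho S (lam S y z) x) (rho S z y).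
Proof.
have := sol_braid S (x, y, z); rewrite /= /r_id /id_r.
by do 6! rewrite sol_mapE /=; case.
Qed.

(** The derived rack: for the [y] with [lam S x y = u], it sends [x] to [lam S u v], where
    [S (x, y) = (u, v)]. *)
Definition rack u x : X := lam S u (rho S (lamV S x u) x).

Lemma lam_rack x u y : rack (lam S x u) (lam S x y) = lam S x (rack u y).
Proof.
(* In this form of [u] the braid relation at [(x, y, z)] applies. *)
have [z ->] : exists z, u = lam S y z by exists (lamV S y u); rewrite lamVK.
by rewrite /rack lamK {2}(lam_lam x y z) lamK rho_lam -lam_lam.
Qed.

Lemma lamV_rack x u y : rack (lamV S x u) (lamV S x y) = lamV S x (rack u y).
Proof. by apply: (can_inj (lamK S x)); rewrite -lam_rack !lamVK. Qed.

Lemma rack_inj u : injective (rack u).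
Proof.
move=> x y /(can_inj (lamK S u)) eq_rho.
have: S (x, lamV S x u) = S (y, lamV S y u).
  by rewrite !sol_mapE !lamVK eq_rho.
by move/(bij_inj (sol_bij S)) => [].
Qed.

Definition diag x : X := lamV S x x.
Definition codiag x : X := rhoV S x x.
(** The pairs [(x, diag x)] are then the fixed points of [S]. Unlike injectivity, this condition is
    a pair of laws and passes to quotients. *)
Definition diag_invertible : Prop := cancel codiag diag /\ cancel diag codiag.

(* In the structure skew brace [rack u] is additive conjugation by u, x maps to
   - u + x + u; this is a term for the inverse operation. *)
Definition rackV u x : X :=
  let y := codiag (lamV S x u) in lam S x (lamV S y (diag (rhoV S y x))).

Lemma rackVK u : diag_invertible -> cancel (rackV u) (rack u).
Proof.
move=> [codiagK _] x; rewrite /rackV; set y := codiag _; set w := rhoV S y x.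
(* As [S (w, y) = (lam S w y, x)], this is [lam_lam] at [w], [y]. It makes [u] and [rackV u x] the
   images of [lam S w y] and [w] under one map [lamV], which [rack] respects. *)
have eq_lam z : lam S x (lamV S y z) = lamV S (lam S w y) (lam S w z).
  apply: (can_inj (lamK S (lam S w y))); rewrite lamVK.
  by rewrite -{2}[z](lamVK S y) (lam_lam w y) rhoVK.
have eq_u : u = lamV S (lam S w y) (lam S w y).
  by rewrite -eq_lam -/(diag y) codiagK lamVK.
rewrite eq_lam /diag lamVK {1}eq_u lamV_rack /rack lamK.
by rewrite lamK rhoVK.
Qed.

Lemma rackK u : diag_invertible -> cancel (rack u) (rackV u).
Proof. by move=> dS x; apply: (@rack_inj u); rewrite rackVK. Qed.

(** Recovers [x] from [S (x, y)] by a term, so that a congruence for the four operations is also one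
    for the inverse of [S]. *)
Lemma rackV_sol_map x y u v :
  diag_invertible -> S (x, y) = (u, v) -> x = rackV u (lam S u v).
Proof.
move=> dS; rewrite sol_mapE => -[<- <-].
by rewrite -{1}[x](rackK (lam S x y) dS) /rack lamK.
Qed.

Definition sim x y : Prop :=
  forall m : X -> X, in_W S m -> lam S (m x) =1 lam S (m y).

Lemma sim_refl x : sim x x. Proof. by []. Qed.

Lemma sim_sym x y : sim x y -> sim y x.
Proof. by move=> sxy m Wm z; rewrite sxy. Qed.

Lemma sim_trans x y z : sim x y -> sim y z -> sim x z.
Proof. by move=> sxy syz m Wm t; rewrite sxy // syz. Qed.

Lemma sim_W m x y : in_W S m -> sim x y -> sim (m x) (m y).
Proof. by move=> Wm sxy m' Wm'; exact: (sxy (m' \o m) (W_comp Wm' Wm)). Qed.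

Lemma sim_lam_eq x y : sim x y -> lam S x =1 lam S y.
Proof. by move=> sxy; exact: (sxy id (W_id S)). Qed.

Lemma lam_lamV_eq x y : lam S x =1 lam S y -> lamV S x =1 lamV S y.
Proof.
by move=> exy z; apply: (can_inj (lamK S x)); rewrite lamVK exy lamVK.
Qed.

Lemma sim_lam x x' y y' :
  sim x x' -> sim y y' -> sim (lam S x y) (lam S x' y').
Proof.
by move=> sx sy; rewrite (sim_lam_eq sx); apply: sim_W sy; apply: W_lam.
Qed.

Lemma sim_lamV x x' y y' :
  sim x x' -> sim y y' -> sim (lamV S x y) (lamV S x' y').
Proof.
move=> sx sy; rewrite (lam_lamV_eq (sim_lam_eq sx)).
by apply: sim_W sy; apply: W_lamV.
Qed.

(** The maps [D_z] in W(X) are what lets the subscript of [rho] vary. *)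
Lemma sim_rho x x' y y' :
  sim x x' -> sim y y' -> sim (rho S x y) (rho S x' y').
Proof.
move=> sx sy; apply: (@sim_trans _ (rho S x y')).
  exact: (sim_W (W_rho S x) sy).
exact: (sim_W (W_D S y') sx).
Qed.

Lemma sim_rhoV x x' y y' :
  sim x x' -> sim y y' -> sim (rhoV S x y) (rhoV S x' y').
Proof.
move=> sx sy; apply: (@sim_trans _ (rhoV S x y')).
  exact: (sim_W (W_rhoV S x) sy).
(* No generator of W(X) varies the subscript of [rhoV]; applying [rho S x] to both sides reduces the
   claim to [sim_rho]. *)
rewrite -[rhoV S x' y'](rhoK S x); apply: (sim_W (W_rhoV S x)).
rewrite -{1}[y'](rhoVK S x').
by apply: sim_rho => //; apply: sim_sym.
Qed.

Lemma sim_rackV u u' x x' :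
  sim u u' -> sim x x' -> sim (rackV u x) (rackV u' x').
Proof.
move=> su sx; rewrite /rackV.
have sy : sim (codiag (lamV S x u)) (codiag (lamV S x' u')).
  by apply: sim_rhoV; apply: sim_lamV.
apply: sim_lam => //; apply: sim_lamV => //.
by apply: sim_lamV; apply: sim_rhoV.
Qed.

Lemma sim_sol_map_inv x y x' y' : diag_invertible ->
    sim (lam S x y) (lam S x' y') -> sim (rho S y x) (rho S y' x') ->
  sim x x' /\ sim y y'.
Proof.
move=> dS su sv.
have sx : sim x x'.
  rewrite (rackV_sol_map dS (sol_mapE x y)) (rackV_sol_map dS (sol_mapE x' y')).
  by apply: sim_rackV => //; apply: sim_lam.
by split=> //; rewrite -(lamK S x y) -(lamK S x' y'); apply: sim_lamV.
Qed.

Definition simb : rel {classic X} := fun x y => `[< sim x y >].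

Lemma simb_refl : reflexive simb.
Proof. by move=> x; apply/asboolP/sim_refl. Qed.

Lemma simb_sym : symmetric simb.
Proof.
move=> x y; apply/asboolP/asboolP; exact: sim_sym.
Qed.

Lemma simb_trans : transitive simb.
Proof.
move=> y x z /asboolP sxy /asboolP syz; apply/asboolP; exact: sim_trans syz.
Qed.

Canonical sim_equiv := EquivRel simb simb_refl simb_sym simb_trans.

Definition sim_quot : Type := {eq_quot sim_equiv}.

Definition sim_pi (x : X) : sim_quot :=
  \pi_({eq_quot sim_equiv}) (x : {classic X}).
Definition sim_repr (a : sim_quot) : X :=
  generic_quotient.repr (a : {eq_quot sim_equiv}).

Lemma sim_reprK a : sim_pi (sim_repr a) = a.
Proof. exact: reprK. Qed.

Lemma sim_piP x y : sim_pi x = sim_pi y <-> sim x y.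
Proof.
split; first by move/eqquotP/asboolP.
by move=> sxy; apply/eqquotP/asboolP.
Qed.

Lemma sim_pi_repr x : sim (sim_repr (sim_pi x)) x.
Proof. by apply/sim_piP; rewrite sim_reprK. Qed.

Definition quot_map (p : sim_quot * sim_quot) : sim_quot * sim_quot :=
  (sim_pi (lam S (sim_repr p.1) (sim_repr p.2)),
   sim_pi (rho S (sim_repr p.2) (sim_repr p.1))).

Lemma quot_mapE x y :
  quot_map (sim_pi x, sim_pi y) = (sim_pi (lam S x y), sim_pi (rho S y x)).
Proof.
rewrite /quot_map /=; congr pair; apply/sim_piP.
  by apply: sim_lam; apply: sim_pi_repr.
by apply: sim_rho; apply: sim_pi_repr.
Qed.

Lemma quot_nonempty : inhabited sim_quot.
Proof. by case: (sol_nonempty S) => x; constructor; apply: (sim_pi x). Qed.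

Lemma quot_bij : diag_invertible -> bijective quot_map.
Proof.
move=> dS; case: (sol_bij S) => g gK Kg.
pose g' (p : sim_quot * sim_quot) :=
  let q := g (sim_repr p.1, sim_repr p.2) in (sim_pi q.1, sim_pi q.2).
exists g' => -[a b]; rewrite -[a]sim_reprK -[b]sim_reprK.
  set x := sim_repr a; set y := sim_repr b; rewrite quot_mapE /g' /=.
  set u := sim_repr (sim_pi (lam S x y)); set v := sim_repr (sim_pi (rho S y x)).
  case Dq: (g (u, v)) => [x' y'] /=.
  have : S (x', y') = (u, v) by rewrite -Dq Kg.
  rewrite sol_mapE => -[Eu Ev].
  have [] := @sim_sol_map_inv x' y' x y dS.
  - by rewrite Eu; apply: sim_pi_repr.
  - by rewrite Ev; apply: sim_pi_repr.
  by move=> /sim_piP -> /sim_piP ->.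
set x := sim_repr a; set y := sim_repr b; rewrite /g' /=.
set u := sim_repr (sim_pi x); set v := sim_repr (sim_pi y).
case Dq: (g (u, v)) => [x' y'] /=.
have : S (x', y') = (u, v) by rewrite -Dq Kg.
rewrite quot_mapE sol_mapE => -[-> ->].
by congr pair; apply/sim_piP; apply: sim_pi_repr.
Qed.

Lemma quot_braid : r_id quot_map \o id_r quot_map \o r_id quot_map
  =1 id_r quot_map \o r_id quot_map \o id_r quot_map.
Proof.
move: quot_map quot_mapE => q qE [[a b] c].
rewrite -[a]sim_reprK -[b]sim_reprK -[c]sim_reprK.
have := sol_braid S (sim_repr a, sim_repr b, sim_repr c).
move: (sim_repr a) (sim_repr b) (sim_repr c) => x y z.
rewrite /= /r_id /id_r; do 6! rewrite sol_mapE qE /=.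
by case=> -> -> ->.
Qed.

Lemma quot_lam_bij a : bijective (lam_of quot_map a).
Proof.
rewrite -[a]sim_reprK; set x := sim_repr a.
exists (fun b => sim_pi (lamV S x (sim_repr b))) => b.
  rewrite -[b]sim_reprK /lam_of quot_mapE /=; apply/sim_piP.
  rewrite -{2}[sim_repr b](lamK S x); apply: sim_lamV => //.
  exact: sim_pi_repr.
by rewrite /lam_of quot_mapE /= lamVK sim_reprK.
Qed.

Lemma quot_rho_bij a : bijective (rho_of quot_map a).
Proof.
rewrite -[a]sim_reprK; set x := sim_repr a.
exists (fun b => sim_pi (rhoV S x (sim_repr b))) => b.
  rewrite -[b]sim_reprK /rho_of quot_mapE /=; apply/sim_piP.
  rewrite -{2}[sim_repr b](rhoK S x); apply: sim_rhoV => //.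
  exact: sim_pi_repr.
by rewrite /rho_of quot_mapE /= rhoVK sim_reprK.
Qed.

Definition sim_solution (dS : diag_invertible) : solution sim_quot :=
  Solution quot_nonempty (quot_bij dS) quot_braid quot_lam_bij quot_rho_bij.

Lemma sim_pi_morphism dS : sol_morphism S (sim_solution dS) sim_pi.
Proof. by move=> x y; rewrite /= quot_mapE sol_mapE. Qed.
End SolutionTheory.

(** * Transport of terms and nilpotency along morphisms *)

Section Morphism.
Variables (X Y : Type) (S : solution X) (T : solution Y) (f : X -> Y).
Hypothesis fM : sol_morphism S T f.

Lemma morph_lam x y : f (lam S x y) = lam T (f x) (f y).
Proof. by rewrite {2}/lam /lam_of fM. Qed.

Lemma morph_rho x y : f (rho S x y) = rho T (f x) (f y).
Proof. by rewrite {2}/rho /rho_of fM. Qed.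

Lemma morph_lamV x y : f (lamV S x y) = lamV T (f x) (f y).
Proof. by apply: (can_inj (lamK T (f x))); rewrite -morph_lam !lamVK. Qed.

Lemma morph_rhoV x y : f (rhoV S x y) = rhoV T (f x) (f y).
Proof. by apply: (can_inj (rhoK T (f x))); rewrite -morph_rho !rhoVK. Qed.

Lemma morph_eval (V : Type) (e : V -> X) t :
  f (eval S e t) = eval T (f \o e) t.
Proof.
by elim: t => //= a <- b <-; rewrite (morph_lam, morph_rho, morph_lamV, morph_rhoV).
Qed.

Lemma morph_lam_pow a x y : f (lam_pow S a x y) = lam_pow T a (f x) (f y).
Proof. by case: a; [apply: morph_lamV | apply: morph_lam]. Qed.

Lemma morph_W (m : W S) : {m' : W T | f \o sval m =1 sval m' \o f}.
Proof.
suff: exists m' : W T, f \o sval m =1 sval m' \o f by move/cid.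
case: m => m /=; elim=> [x|x|x|x|z||g h _ [g' Eg] _ [h' Eh]].
- by exists (exist _ _ (W_lam T (f x))) => y; apply: morph_lam.
- by exists (exist _ _ (W_lamV T (f x))) => y; apply: morph_lamV.
- by exists (exist _ _ (W_rho T (f x))) => y; apply: morph_rho.
- by exists (exist _ _ (W_rhoV T (f x))) => y; apply: morph_rhoV.
- by exists (exist _ _ (W_D T (f z))) => y; apply: morph_rho.
- by exists (exist _ _ (W_id T)).
exists (exist _ _ (W_comp (svalP g') (svalP h'))) => x /=.
by have /= -> := Eg (h x); have /= -> := Eh x.
Qed.

Lemma lift_W (g : Y -> X) : cancel g f ->
  forall m : W T, {m' : W S | f \o sval m' =1 sval m \o f}.
Proof.
move=> gK m; suff: exists m' : W S, f \o sval m' =1 sval m \o f by move/cid.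
case: m => m /=; elim=> [x|x|x|x|z||m1 m2 _ [m1' E1] _ [m2' E2]].
- by exists (exist _ _ (W_lam S (g x))) => y; rewrite /= morph_lam gK.
- by exists (exist _ _ (W_lamV S (g x))) => y; rewrite /= morph_lamV gK.
- by exists (exist _ _ (W_rho S (g x))) => y; rewrite /= morph_rho gK.
- by exists (exist _ _ (W_rhoV S (g x))) => y; rewrite /= morph_rhoV gK.
- by exists (exist _ _ (W_D S (g z))) => y; rewrite /= morph_rho gK.
- by exists (exist _ _ (W_id S)).
exists (exist _ _ (W_comp (svalP m1') (svalP m2'))) => x /=.
by have /= -> := E1 (sval m2' x); have /= -> := E2 x.
Qed.

(** Indexing both lists of data by [J] serves two directions: [J] is the data over [S] when a law is
    pulled back, and the data over [T] when it is pushed forward. *)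
Lemma morph_lam_multi (J : Type) (d : J -> W S * bool * X)
    (d' : J -> W T * bool * Y) :
    (forall j, [/\ f \o sval (d j).1.1 =1 sval (d' j).1.1 \o f,
       (d' j).1.2 = (d j).1.2 & (d' j).2 = f (d j).2]) ->
  forall a v (s : seq J) x,
    f (lam_multi a v (map d s) x) = lam_multi a (f v) (map d' s) (f x).
Proof.
move=> dd' a v s; rewrite /lam_multi.
have: forall x, f (lam_pow S a v x) = lam_pow T a (f v) (f x).
  by move=> x; apply: morph_lam_pow.
elim: s (lam_pow S a v) (lam_pow T a (f v)) => //= j s IHs F G FG x.
apply: IHs => {}x; case: (d j) (d' j) (dd' j) => [[m b] w] [[m' b'] w'] /=.
case=> Em -> ->; rewrite morph_lam_pow.
by have /= -> := Em (F w); rewrite FG.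
Qed.
End Morphism.

Lemma lam_multi_rcons (X : Type) (S : solution X) a v
    (s : seq (W S * bool * X)) m b w :
  lam_multi a v (rcons s (m, b, w)) = lam_pow S b (sval m (lam_multi a v s w)).
Proof. by rewrite /lam_multi -cats1 foldl_cat. Qed.

Section RNS.
Variables (X Y : Type) (S : solution X) (T : solution Y) (f : X -> Y).
Hypothesis fM : sol_morphism S T f.

(** The outermost lambda depends only on the image of its subscript under [f], and there the law of
    class [n] in [T] applies. *)
Lemma RNS_pull n : (forall x y, f x = f y -> lam S x =1 lam S y) ->
  0 < n -> RNS T n -> RNS S n.+1.
Proof.
move=> f_lam n_gt0 nilT.
have f_lam_pow a x y : f x = f y -> lam_pow S a x =1 lam_pow S a y.
  by move/f_lam; case: a => //; apply: lam_lamV_eq.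
case: n n_gt0 nilT => // -[|n] _ nilT a1 a2 v1 v2 m2 [s /= /eqP size_s].
  move/size0nil: size_s => ->; rewrite /lam_multi /=; apply: f_lam_pow.
  have [m' /= Em] := morph_W fM m2; have Em' x := Em x; rewrite /= in Em'.
  rewrite !Em' (morph_lam_pow fM); congr (sval m' _).
  by case: a1 => /=; [apply: (can_inj (lamK T (f v1))); rewrite lamVK|]; rewrite nilT.
elim/last_ind: s size_s => // s [[m a] v] _; rewrite size_rcons => -[size_s].
rewrite -rcons_cons !lam_multi_rcons; apply: f_lam_pow.
have [m' /= Em] := morph_W fM m; have Em' x := Em x; rewrite /= in Em'.
rewrite !Em'; congr (sval m' _).
pose d (j : W S * bool * X) : W T * bool * Y :=
  (sval (morph_W fM j.1.1), j.1.2, f j.2).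
have dP j : [/\ f \o sval j.1.1 =1 sval (d j).1.1 \o f,
    (d j).1.2 = j.1.2 & (d j).2 = f j.2].
  by split=> //; apply: (svalP (morph_W fM j.1.1)).
rewrite -[_ :: s]map_id -[s in RHS]map_id !(morph_lam_multi fM dP) /=.
have size_ds : size (map d s) == n by rewrite size_map size_s.
have /= -> := nilT a1 a2 (f v1) (f v2) (sval (morph_W fM m2)) (Tuple size_ds) (f v).
have /= E2 := svalP (morph_W fM m2) v2.
by rewrite E2.
Qed.

(** One more entry, with arbitrary [m], is appended to the data: the law of class [n.+1] then says
    that both sides of the law of class [n] have the same lambda after every [m], so [f] identifies
    them. *)
Lemma RNS_push n (g : Y -> X) : cancel g f ->
    (forall x y, (forall m : W S, lam S (sval m x) =1 lam S (sval m y)) ->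
       f x = f y) ->
  0 < n -> RNS S n.+1 -> RNS T n.
Proof.
move=> gK f_sim n_gt0 nilS.
case: n n_gt0 nilS => // -[|n] _ nilS.
  move=> v1 v2; rewrite -[v1]gK -[v2]gK -(morph_lam fM); apply: f_sim => m x.
  exact: (nilS false false (g v1) (g v2) m [tuple] x).
move=> a1 a2 v1 v2 m2 s y.
pose d (j : W T * bool * Y) : W S * bool * X :=
  (sval (lift_W fM gK j.1.1), j.1.2, g j.2).
have dP j : [/\ f \o sval (d j).1.1 =1 sval j.1.1 \o f,
    j.1.2 = (d j).1.2 & j.2 = f (d j).2].
  by split=> //; [apply: (svalP (lift_W fM gK j.1.1)) | rewrite gK].
rewrite -[y]gK -[v1]gK -[v2]gK -[sval m2 _](svalP (lift_W fM gK m2) (g v2)).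
rewrite -[_ :: s]map_id -[tval s in RHS]map_id.
rewrite -!(morph_lam_multi fM dP) /=.
apply: f_sim => m x.
have size_s : size (rcons (map d s) (m, false, g y)) == n.+1.
  by rewrite size_rcons size_map size_tuple.
have /= := nilS a1 a2 (g v1) (g v2) (sval (lift_W fM gK m2)) (Tuple size_s) x.
by rewrite -rcons_cons !lam_multi_rcons /= /d /= gK.
Qed.
End RNS.

Local Open Scope group_scope.

(** * The structure group *)

Fixpoint word_val (T : Type) (H : groupType) (f : T -> H) (w : group_word T) : H :=
  match w with
  | Gen x => f x
  | GOne => 1
  | GMul a b => word_val f a * word_val f b
  | GInv a => (word_val f a)^-1
  end.

Fixpoint word_map (T U : Type) (f : T -> U) (w : group_word T) : group_word U :=
  match w with
  | Gen x => Gen (f x)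
  | GOne => GOne
  | GMul a b => GMul (word_map f a) (word_map f b)
  | GInv a => GInv (word_map f a)
  end.

Lemma word_val_map (T U : Type) (H : groupType) (f : T -> U) (h : U -> H) w :
  word_val h (word_map f w) = word_val (h \o f) w.
Proof. by elim: w => //= [a -> b ->|a ->]. Qed.

Lemma word_val_sg_eq (X : Type) (S : solution X) (H : groupType) (f : X -> H) :
    (forall x y, f x * f y = f (lam S x y) * f (rho S y x)) ->
  forall a b, sg_eq S a b -> word_val f a = word_val f b.
Proof.
move=> fM a b; elim=> //=.
- by move=> {}a {}b c _ -> _ ->.
- by move=> {}a a' {}b b' _ -> _ ->.
- by move=> {}a a' _ ->.
- by move=> {}a {}b c; rewrite mulgA.
- by move=> {}a; rewrite mul1g.
- by move=> {}a; rewrite mulg1.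
- by move=> {}a; rewrite mulVg.
- by move=> {}a; rewrite mulgV.
by move=> x y u v; rewrite sol_mapE => -[<- <-]; apply: fM.
Qed.

(* The two components are the action of a word and that of its inverse. *)
Fixpoint word_act (T X : Type) (L LV : T -> X -> X) (w : group_word T)
    : (X -> X) * (X -> X) :=
  match w with
  | Gen x => (L x, LV x)
  | GOne => (id, id)
  | GMul a b => ((word_act L LV a).1 \o (word_act L LV b).1,
                 (word_act L LV b).2 \o (word_act L LV a).2)
  | GInv a => ((word_act L LV a).2, (word_act L LV a).1)
  end.

Section WordAction.
Variables (T X : Type) (L LV : T -> X -> X).
Hypotheses (LK : forall t, cancel (L t) (LV t))
  (LVK : forall t, cancel (LV t) (L t)).

Lemma word_actK w :
  cancel (word_act L LV w).1 (word_act L LV w).2 /\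
  cancel (word_act L LV w).2 (word_act L LV w).1.
Proof.
elim: w => [t||a [aK Ka] b [bK Kb]|a [aK Ka]] //=.
by split=> x /=; rewrite ?aK ?bK ?Ka ?Kb.
Qed.

Lemma eq_word_actV a b : (word_act L LV a).1 =1 (word_act L LV b).1 ->
  (word_act L LV a).2 =1 (word_act L LV b).2.
Proof.
move=> eq_ab x; apply: (can_inj (word_actK a).1).
by rewrite (word_actK a).2 eq_ab (word_actK b).2.
Qed.

(** The set acted on is kept apart from the generators, since the structure group of the quotient
    has to act on the original set. *)
Lemma word_act_sg_eq (S : solution T) :
    (forall x y z, L x (L y z) = L (lam S x y) (L (rho S y x) z)) ->
  forall a b, sg_eq S a b -> (word_act L LV a).1 =1 (word_act L LV b).1.
Proof.
move=> LM a b; elim=> //=.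
- by move=> {}a {}b _ ab x; rewrite ab.
- by move=> {}a {}b c _ ab _ bc x; rewrite ab bc.
- by move=> {}a a' {}b b' _ aa' _ bb' x /=; rewrite aa' bb'.
- by move=> {}a a' _; apply: eq_word_actV.
- by move=> {}a; apply: (word_actK a).1.
- by move=> {}a; apply: (word_actK a).2.
by move=> x y u v; rewrite sol_mapE => -[<- <-] z /=; apply: LM.
Qed.
End WordAction.

Lemma word_act_map (T U X : Type) (L LV : U -> X -> X) (f : T -> U) w :
  word_act L LV (word_map f w) = word_act (L \o f) (LV \o f) w.
Proof. by elim: w => //= [a -> b ->|a ->]. Qed.

Section StructureGroup.
Variables (X : Type) (S : solution X).

Definition sgb : rel {classic (group_word X)} := fun a b => `[< sg_eq S a b >].

Lemma sgb_refl : reflexive sgb.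
Proof. by move=> a; apply/asboolP/sg_refl. Qed.

Lemma sgb_sym : symmetric sgb.
Proof. by move=> a b; apply/asboolP/asboolP; apply: sg_sym. Qed.

Lemma sgb_trans : transitive sgb.
Proof.
move=> b a c /asboolP ab /asboolP bc; apply/asboolP; exact: sg_trans ab bc.
Qed.

Canonical sg_equiv := EquivRel sgb sgb_refl sgb_sym sgb_trans.

Definition sgroup : Type := {eq_quot sg_equiv}.
HB.instance Definition _ := Choice.on sgroup.

Definition sg_pi (w : group_word X) : sgroup :=
  \pi_({eq_quot sg_equiv}) (w : {classic (group_word X)}).
Definition sg_repr (g : sgroup) : group_word X :=
  generic_quotient.repr (g : {eq_quot sg_equiv}).

Lemma sg_reprK g : sg_pi (sg_repr g) = g.
Proof. exact: reprK. Qed.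

Lemma sg_piP a b : sg_pi a = sg_pi b <-> sg_eq S a b.
Proof.
split; first by move/eqquotP/asboolP.
by move=> ab; apply/eqquotP/asboolP.
Qed.

Lemma sg_repr_pi a : sg_eq S (sg_repr (sg_pi a)) a.
Proof. by apply/sg_piP; rewrite sg_reprK. Qed.

Let sg_one := sg_pi GOne.
Let sg_inv_op g := sg_pi (GInv (sg_repr g)).
Let sg_mul_op g h := sg_pi (GMul (sg_repr g) (sg_repr h)).

Let sg_piM a b : sg_pi (GMul a b) = sg_mul_op (sg_pi a) (sg_pi b).
Proof. by apply/sg_piP; apply: sg_mul; apply: sg_sym; apply: sg_repr_pi. Qed.

Let sg_piV a : sg_pi (GInv a) = sg_inv_op (sg_pi a).
Proof. by apply/sg_piP; apply: sg_inv; apply: sg_sym; apply: sg_repr_pi. Qed.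

Let sg_mulgA : associative sg_mul_op.
Proof.
move=> a b c; rewrite -[a]sg_reprK -[b]sg_reprK -[c]sg_reprK -!sg_piM.
exact/sg_piP/sg_mulA.
Qed.

Let sg_mul1 : left_id sg_one sg_mul_op.
Proof. by move=> a; rewrite -[a]sg_reprK -sg_piM; apply/sg_piP/sg_mul1g. Qed.

Let sg_mulg1' : right_id sg_one sg_mul_op.
Proof. by move=> a; rewrite -[a]sg_reprK -sg_piM; apply/sg_piP/sg_mulg1. Qed.

Let sg_mulV : left_inverse sg_one sg_inv_op sg_mul_op.
Proof.
by move=> a; rewrite -[a]sg_reprK -sg_piV -sg_piM; apply/sg_piP/sg_mulVg.
Qed.

Let sg_mulgV' : right_inverse sg_one sg_inv_op sg_mul_op.
Proof.
by move=> a; rewrite -[a]sg_reprK -sg_piV -sg_piM; apply/sg_piP/sg_mulgV.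
Qed.

HB.instance Definition _ := isGroup.Build sgroup
  sg_mulgA sg_mul1 sg_mulg1' sg_mulV sg_mulgV'.

Definition sgen (x : X) : sgroup := sg_pi (Gen x).

Lemma sg_piE w : sg_pi w = word_val sgen w.
Proof.
elim: w => //= [a IHa b IHb|a IHa]; first by rewrite -IHa -IHb sg_piM.
by rewrite -IHa sg_piV.
Qed.

Lemma gen_rel x y : sgen x * sgen y = sgen (lam S x y) * sgen (rho S y x).
Proof.
rewrite -[LHS]/(sg_mul_op _ _) -[RHS]/(sg_mul_op _ _) -!sg_piM.
by apply/sg_piP; apply: sg_rel; apply: sol_mapE.
Qed.

Lemma word_val_gen (T : Type) (f : T -> X) a b :
  word_val (sgen \o f) a = word_val (sgen \o f) b <->
  sg_eq S (word_map f a) (word_map f b).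
Proof.
rewrite -(word_val_map f sgen a) -(word_val_map f sgen b) -!sg_piE.
exact: sg_piP.
Qed.

Lemma injective_gen : injective_solution S -> injective sgen.
Proof. by move=> injS x y /sg_piP /injS. Qed.

(** Cancellation in the structure group: if [S] fixes one coordinate of a pair, the defining
    relation forces it to fix the other one. *)
Lemma injective_diag : injective_solution S -> diag_invertible S.
Proof.
move/injective_gen => gen_inj.
suff lam_codiag x : lam S (codiag S x) x = codiag S x.
  split=> x; rewrite /diag.
    by rewrite -{2}(lam_codiag x) lamK.
  set t := lamV S x x; apply: (can_inj (rhoK S t)); rewrite rhoVK.
  apply: gen_inj; apply: (mulgI (sgen x)).
  by rewrite -{2}(lamVK S x x) -/t gen_rel lamVK.
apply: gen_inj; apply: (mulIg (sgen x)).
by rewrite [RHS]gen_rel rhoVK.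
Qed.

Definition sgact (g : sgroup) : X -> X :=
  (word_act (lam S) (lamV S) (sg_repr g)).1.

Lemma sgact_pi w : sgact (sg_pi w) =1 (word_act (lam S) (lamV S) w).1.
Proof.
apply: (word_act_sg_eq (lamK S) (lamVK S) (@lam_lam _ S)).
exact: sg_repr_pi.
Qed.

Lemma sgactM g h x : sgact (g * h) x = sgact g (sgact h x).
Proof. exact: (sgact_pi (GMul (sg_repr g) (sg_repr h)) x). Qed.

Lemma sgact1 x : sgact 1 x = x.
Proof. exact: (sgact_pi GOne x). Qed.

Lemma sgact_gen x y : sgact (sgen x) y = lam S x y.
Proof. by rewrite sgact_pi. Qed.

Lemma sgactK g : cancel (sgact g) (sgact g^-1).
Proof. by move=> x; rewrite -sgactM mulVg sgact1. Qed.

Lemma sgactVK g : cancel (sgact g^-1) (sgact g).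
Proof. by move=> x; rewrite -sgactM mulgV sgact1. Qed.

Lemma sgact_genV x y : sgact (sgen x)^-1 y = lamV S x y.
Proof. by apply: (can_inj (lamK S x)); rewrite lamVK -sgact_gen sgactVK. Qed.

Lemma sgact_word_val (T : Type) (f : T -> X) w :
  sgact (word_val (sgen \o f) w) =1 (word_act (lam S \o f) (lamV S \o f) w).1.
Proof.
by move=> x; rewrite -(word_val_map f sgen w) -sg_piE sgact_pi word_act_map.
Qed.

Lemma sgact_rack g u x : rack S (sgact g u) (sgact g x) = sgact g (rack S u x).
Proof.
rewrite -[g]sg_reprK sg_piE; elim: (sg_repr g) u x => /= [z||a IHa b IHb|a IHa] u x.
- by rewrite !sgact_gen lam_rack.
- by rewrite !sgact1.
- by rewrite !sgactM IHa IHb.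
by apply: (can_inj (sgactK (word_val sgen a))); rewrite -IHa !sgactVK.
Qed.

(* Right addition of x in the structure skew brace: h |-> h + x. *)
Definition sg_add x h : sgroup := h * sgen (sgact h^-1 x).
(** For [w = codiag S z] one has [lam S w z = w], so 0 = w^-1 w = w^-1 + z: the inverse of the
    generator [w] is the additive inverse of [z]. *)
Definition sg_sub x h : sgroup := h * (sgen (codiag S (sgact h^-1 x)))^-1.

Lemma sg_addK x : diag_invertible S -> cancel (sg_add x) (sg_sub x).
Proof.
move=> [_ diagK] h; rewrite /sg_sub /sg_add.
by rewrite invMg sgactM sgact_genV -/(diag S _) diagK mulgK.
Qed.

Lemma sg_subK x : diag_invertible S -> cancel (sg_sub x) (sg_add x).
Proof.
move=> [codiagK _] h; rewrite /sg_sub /sg_add.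
set z := sgact h^-1 x; rewrite invMg invgK sgactM -/z sgact_gen.
suff -> : lam S (codiag S z) z = codiag S z by rewrite mulgKV.
by rewrite -{2}(codiagK z) /diag lamVK.
Qed.

Lemma sg_addM g x h : sg_add (sgact g x) (g * h) = g * sg_add x h.
Proof. by rewrite /sg_add invMg sgactM sgactK mulgA. Qed.

Lemma sg_subM g x h : sg_sub (sgact g x) (g * h) = g * sg_sub x h.
Proof. by rewrite /sg_sub invMg sgactM sgactK mulgA. Qed.

Lemma sg_add1 x : sg_add x 1 = sgen x.
Proof. by rewrite /sg_add mul1g invg1 sgact1. Qed.

Lemma sg_add_rack u x h : sg_add u (sg_add x h) = sg_add (rack S u x) (sg_add u h).
Proof.
(* Left multiplication by [h] moves the claim to [h = 1], where it is a defining relation between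
   products of two generators. *)
suff base v y : sg_add v (sg_add y 1) = sg_add (rack S v y) (sg_add v 1).
  have sg_add_h z : sg_add (sgact h z) h = h * sg_add z 1 by rewrite -sg_addM mulg1.
  by rewrite -[u](sgactVK h) -[x](sgactVK h) sgact_rack !sg_add_h !sg_addM base.
rewrite !sg_add1 /sg_add !sgact_genV gen_rel lamVK.
by rewrite /rack lamK.
Qed.
End StructureGroup.

(** * Terms as walks in the structure group *)

Section Letters.
Variable V : Type.

Definition word : Type := group_word (term V).

(* The letter (s, g, y) stands for the additive generator g . y, negated when s
   is [true]. *)
Definition letter : Type := bool * word * V.

Definition act_letters (u : word) (l : seq letter) : seq letter :=
  [seq (a.1.1, GMul u a.1.2, a.2) | a <- l].

Definition opp_letter (a : letter) : letter := (~~ a.1.1, a.1.2, a.2).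

Definition opp_letters (l : seq letter) : seq letter := rev (map opp_letter l).

(* In a skew brace rho_y(x) = (lam_x y)^-1 . (- lam_x y + x + lam_x y); the
   [RhoV] clause solves this for x. *)
Fixpoint term_letters (t : term V) : seq letter :=
  match t with
  | Var y => [:: (false, GOne, y)]
  | Lam a b => act_letters (Gen a) (term_letters b)
  | LamV a b => act_letters (GInv (Gen a)) (term_letters b)
  | Rho a b =>
      let d := act_letters (Gen a) (term_letters b) in
      act_letters (GInv (Gen (Lam a b))) (opp_letters d ++ term_letters a ++ d)
  | RhoV a b =>
      let w := Gen (RhoV a b) in
      let d := act_letters w (term_letters b) in
      d ++ act_letters (GMul (GMul w (Gen b)) (GInv (Gen a))) (term_letters a)
        ++ opp_letters d
  end.

(** The skew brace rules a b = a + a . b and a^-1 = a^-1 . (- a). The acting words inside letters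
    are not expanded further: they matter only through their action on X. *)
Fixpoint letters (w : word) : seq letter :=
  match w with
  | Gen t => term_letters t
  | GOne => [::]
  | GMul a b => letters a ++ act_letters a (letters b)
  | GInv a => act_letters (GInv a) (opp_letters (letters a))
  end.
End Letters.

Section Trajectory.
Variables (X : Type) (S : solution X) (V : Type) (e : V -> X).

Definition sg_eval (w : word V) : sgroup S := word_val (sgen S \o eval S e) w.

Definition walk_step (h : sgroup S) (a : letter V) : sgroup S :=
  let x := sgact (sg_eval a.1.2) (e a.2) in
  if a.1.1 then sg_sub x h else sg_add x h.

Definition walk (h : sgroup S) (l : seq (letter V)) : sgroup S :=
  foldl walk_step h l.

Lemma walk_cat h l1 l2 : walk h (l1 ++ l2) = walk (walk h l1) l2.
Proof. exact: foldl_cat. Qed.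

Lemma walk_act u h l :
  walk (sg_eval u * h) (act_letters u l) = sg_eval u * walk h l.
Proof.
elim: l h => //= a l IHl h; rewrite -IHl; congr walk.
by rewrite /walk_step /= /sg_eval /= sgactM; case: a.1.1; rewrite (sg_addM, sg_subM).
Qed.

Hypothesis dS : diag_invertible S.

Lemma step_opp a h : walk_step (walk_step h a) (opp_letter a) = h.
Proof. by rewrite /walk_step /=; case: a.1.1 => /=; rewrite (sg_subK, sg_addK). Qed.

Lemma walk_opp h l : walk (walk h l) (opp_letters l) = h.
Proof.
elim: l h => //= a l IHl h; rewrite /opp_letters /= rev_cons -cats1 walk_cat.
by rewrite -/(opp_letters l) IHl /= step_opp.
Qed.

(** The starting point is arbitrary because the walk of a subterm begins where the preceding one
    ends. *)
Lemma walk_term t h : walk h (term_letters t) = sg_add (eval S e t) h.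
Proof.
have pre u l z : (forall k, walk k l = sg_add z k) -> forall k,
    walk k (act_letters u l) = sg_add (sgact (sg_eval u) z) k.
  move=> lP k; rewrite -{1}[k](mulVKg (sg_eval u)) walk_act lP.
  by rewrite -sg_addM mulVKg.
have oppP l z : (forall k, walk k l = sg_add z k) -> forall k,
    walk k (opp_letters l) = sg_sub z k.
  by move=> lP k; rewrite -{1}[k](sg_subK z dS) -lP walk_opp.
elim: t h => [y|a IHa b IHb|a IHa b IHb|a IHa b IHb|a IHa b IHb] h /=.
- by rewrite /walk_step /= sgact1.
- by rewrite (pre _ _ _ IHb) /sg_eval /= sgact_gen.
- set x := eval S e a in IHa *; set y := eval S e b in IHb *.
  have dP := pre (Gen a) _ _ IHb; rewrite /sg_eval /= sgact_gen in dP.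
  have -> : rho S y x
            = sgact (sg_eval (GInv (Gen (Lam a b)))) (rack S (lam S x y) x).
    by rewrite /sg_eval /= sgact_genV /rack lamK -/x -/y lamK.
  (* This is k - u + x + u = k + (- u + x + u) with [u = lam S x y]. *)
  apply: pre => k; rewrite !walk_cat (oppP _ _ dP) dP IHa.
  by rewrite sg_add_rack sg_subK.
- by rewrite (pre _ _ _ IHb) /sg_eval /= sgact_genV.
set x := eval S e a in IHa *; set y := eval S e b in IHb *; set w := rhoV S y x.
have dP := pre (Gen (RhoV a b)) _ _ IHb.
rewrite /sg_eval /= sgact_gen -/x -/y -/w in dP.
rewrite !walk_cat (oppP _ _ dP) dP (pre _ _ _ IHa).
rewrite /sg_eval /= -/x -/y -/w.
have -> : sgen S w * sgen S y * (sgen S x)^-1 = sgen S (lam S w y).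
  by rewrite gen_rel rhoVK mulgK.
have -> : sgact (sgen S (lam S w y)) x = rack S (lam S w y) w.
  by rewrite sgact_gen /rack lamK rhoVK.
by rewrite -sg_add_rack sg_addK.
Qed.

Lemma walk_letters w : walk 1 (letters w) = sg_eval w.
Proof.
elim: w => [t||a IHa b IHb|a IHa] //=.
- by rewrite walk_term sg_add1.
- by rewrite walk_cat IHa -{1}[sg_eval a]mulg1 walk_act IHb.
have -> : 1 = sg_eval (GInv a) * sg_eval a by rewrite /sg_eval /= mulVg.
by rewrite walk_act -IHa walk_opp mulg1.
Qed.
End Trajectory.

(** * Finite braided groups and wreath products *)

(** The complements of the domain [A] and of its image have the same size; matching their
    enumerations completes the partial injection that [f] induces on [s]. *)
Lemma perm_extension (T : choiceType) (s : seq T) (f : T -> T) :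
    injective f ->
  exists p : {perm seq_sub s}, forall d d', f (val d) = val d' -> p d = d'.
Proof.
move=> f_inj; pose D : finType := seq_sub s.
pose A := [set d : D | f (val d) \in s].
pose f' (d : D) : D := insubd d (f (val d)).
have f'E d : d \in A -> val (f' d) = f (val d).
  by rewrite inE => Ad; rewrite insubdK.
have f'_inj : {in A &, injective f'}.
  by move=> c d Ac Ad /(congr1 val); rewrite !f'E // => /f_inj /val_inj.
have sz : size (enum (~: A)) = size (enum (~: (f' @: A))).
  apply/eqP; rewrite -!cardE -(eqn_add2l #|A|) cardsC.
  by rewrite -(card_in_imset f'_inj) cardsC.
(* The default of [nth] is never reached, as the two enumerations have equal length. *)
pose q d := if d \in A then f' d
            else nth d (enum (~: (f' @: A))) (index d (enum (~: A))).
have q_out d : d \notin A -> q d \notin f' @: A.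
  move=> nAd; rewrite /q (negPf nAd) -in_setC -mem_enum mem_nth //.
  by rewrite -sz index_mem mem_enum inE.
have q_inj : injective q.
  move=> c d; case Ac: (c \in A); case Ad: (d \in A).
  - by rewrite /q Ac Ad; apply: f'_inj.
  - move=> Ecd; have := q_out d (negbT Ad); rewrite -Ecd /q Ac.
    by rewrite imset_f.
  - move=> Ecd; have := q_out c (negbT Ac); rewrite Ecd /q Ad.
    by rewrite imset_f.
  have mem_c : c \in enum (~: A) by rewrite mem_enum inE Ac.
  have mem_d : d \in enum (~: A) by rewrite mem_enum inE Ad.
  rewrite /q Ac Ad (set_nth_default c d) -?sz ?index_mem // => /eqP.
  rewrite nth_uniq ?enum_uniq -?sz ?index_mem // => /eqP Ei.
  by rewrite -(nth_index c mem_c) Ei nth_index.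
exists (perm q_inj) => d d' Ed; rewrite permE /q.
have Ad : d \in A by rewrite inE Ed ssvalP.
by rewrite Ad; apply: val_inj; rewrite f'E.
Qed.

(* Braided groups (skew braces): the compatibility condition [bactD] says that
   rho is a right action. *)
Record braiding (B : finGroupType) := Braiding {
  bact :> B -> B -> B;
  bact1 : forall y, bact 1 y = y;
  bact_one : forall x, bact x 1 = 1;
  bactM : forall x y z, bact (x * y) z = bact x (bact y z);
  bactD : forall x y z,
    bact x (y * z) = bact x y * bact ((bact x y)^-1 * x * y) z
}.

Section BraidedGroup.
Variables (B : finGroupType) (c : braiding B).

Definition brho (y x : B) : B := (c x y)^-1 * x * y.

Lemma bactK x : cancel (c x) (c x^-1).
Proof. by move=> y; rewrite -bactM mulVg bact1. Qed.

Lemma bactVK x : cancel (c x^-1) (c x).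
Proof. by move=> y; rewrite -bactM mulgV bact1. Qed.

Lemma bact_rho x y : c x y * brho y x = x * y.
Proof. by rewrite /brho -!mulgA mulKVg. Qed.

Lemma brhoM y z x : brho (y * z) x = brho z (brho y x).
Proof.
by rewrite {1}/brho bactD -/(brho y x) {2}/brho invMg -!mulgA.
Qed.

Lemma brho1 x : brho 1 x = x.
Proof. by rewrite /brho bact_one invg1 mul1g mulg1. Qed.

Lemma brhoK y : cancel (brho y) (brho y^-1).
Proof. by move=> x; rewrite -brhoM mulgV brho1. Qed.

Lemma brhoVK y : cancel (brho y^-1) (brho y).
Proof. by move=> x; rewrite -brhoM mulVg brho1. Qed.

Definition bmap (p : B * B) : B * B := (c p.1 p.2, brho p.2 p.1).

Lemma bmap_bij : bijective bmap.
Proof.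
apply: injF_bij => -[x y] [x' y'] [Eu Ev].
have Exy : x * y = x' * y' by rewrite -(bact_rho x y) Eu Ev bact_rho.
(* If [(u, v)] is the image of [(x, y)], this reads [brho u x^-1 = v^-1]: so [u] and [v] determine
   [x], and [u * v = x * y] then gives [y]. *)
have brhoV z t : brho (c z t) z^-1 = (brho t z)^-1.
  by rewrite /brho bactK !invMg invgK mulgA.
have Ex : x = x'.
  by apply: invg_inj; apply: (can_inj (brhoK (c x y))); rewrite brhoV Ev Eu brhoV.
by congr pair => //; move: Exy; rewrite Ex => /mulgI.
Qed.

Lemma bmap_braid : r_id bmap \o id_r bmap \o r_id bmap
  =1 id_r bmap \o r_id bmap \o id_r bmap.
Proof.
case=> [[x y] z] /=.
have E1 : c (c x y) (c (brho y x) z) = c x (c y z).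
  by rewrite -!bactM bact_rho.
have E3 : brho z (brho y x) = brho (brho z y) (brho (c y z) x).
  by rewrite -!brhoM bact_rho.
rewrite E1 E3; congr (_, _, _).
(* The outer components agree because [c] and [brho] are actions; the middle ones then agree because
   each triple multiplies to [x * y * z]. *)
apply: (mulgI (c x (c y z))); apply: (mulIg (brho (brho z y) (brho (c y z) x))).
transitivity (x * y * z).
  by rewrite -E1 bact_rho -E3 -mulgA bact_rho mulgA bact_rho.
by rewrite -[RHS]mulgA bact_rho mulgA bact_rho -!mulgA bact_rho.
Qed.

Lemma bmap_lam_bij x : bijective (lam_of bmap x).
Proof. by exists (c x^-1) => y; rewrite /lam_of /= (bactK, bactVK). Qed.

Lemma bmap_rho_bij x : bijective (rho_of bmap x).
Proof. by exists (brho x^-1) => y; rewrite /rho_of /= (brhoK, brhoVK). Qed.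

Definition bsol : solution B :=
  Solution (inhabits 1) bmap_bij bmap_braid bmap_lam_bij bmap_rho_bij.

Lemma lam_bsol x y : lam bsol x y = c x y. Proof. by []. Qed.

Lemma rho_bsol x y : rho bsol x y = brho x y. Proof. by []. Qed.

Lemma lamV_bsol x y : lamV bsol x y = c x^-1 y.
Proof. by apply: (can_inj (lamK bsol x)); rewrite lamVK lam_bsol bactVK. Qed.

(** The identity map of [B] respects the defining relations, hence factors through the structure
    group. *)
Lemma bsol_injective : injective_solution bsol.
Proof.
move=> x y /(word_val_sg_eq (f := id : B -> B)); apply=> u v.
by rewrite lam_bsol rho_bsol bact_rho.
Qed.
End BraidedGroup.

Section Wreath.
Variables (K B : finGroupType).

Definition wreath : Type := ({ffun B -> K} * B)%type.
HB.instance Definition _ := Finite.on wreath.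

Definition wreath_one : wreath := ([ffun=> 1], 1).
Definition wreath_inv (p : wreath) : wreath :=
  ([ffun v => (p.1 (v * p.2^-1))^-1], p.2^-1).
Definition wreath_mul (p q : wreath) : wreath :=
  ([ffun v => p.1 v * q.1 (v * p.2)], p.2 * q.2).

Lemma wreath_mulA : associative wreath_mul.
Proof.
move=> p q r; congr pair; last by rewrite /= mulgA.
by apply/ffunP => v; rewrite !ffunE /= !mulgA.
Qed.

Lemma wreath_mul1 : left_id wreath_one wreath_mul.
Proof.
case=> f x; congr pair; last by rewrite /= mul1g.
by apply/ffunP => v; rewrite !ffunE /= mulg1 mul1g.
Qed.

Lemma wreath_mulV : left_inverse wreath_one wreath_inv wreath_mul.
Proof.
case=> f x; congr pair; last by rewrite /= mulVg.
by apply/ffunP => v; rewrite !ffunE /= mulVg.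
Qed.

HB.instance Definition _ := Finite_isGroup.Build wreath
  wreath_mulA wreath_mul1 wreath_mulV.

Lemma wreathM1 (p q : wreath) v : (p * q).1 v = p.1 v * q.1 (v * p.2).
Proof. by rewrite ffunE. Qed.

Lemma wreathM2 (p q : wreath) : (p * q).2 = p.2 * q.2.
Proof. by []. Qed.

Lemma wreathV1 (p : wreath) v : p^-1.1 v = (p.1 (v * p.2^-1))^-1.
Proof. by rewrite ffunE. Qed.

Lemma wreathV2 (p : wreath) : p^-1.2 = p.2^-1.
Proof. by []. Qed.

Variable c : braiding B.

(** Only [p.2] acts. The additive group is thereby the direct product of the functions from [B] to
    [K] and the additive group of [B], so the first component at a point turns sums into products in
    [K]. *)
Definition wreath_act (p q : wreath) : wreath :=
  ([ffun v => q.1 (v * p.2)], c p.2 q.2).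

Lemma wreath_act1 q : wreath_act 1 q = q.
Proof.
case: q => f x; congr pair; last exact: bact1.
by apply/ffunP => v; rewrite ffunE mulg1.
Qed.

Lemma wreath_act_one p : wreath_act p 1 = 1.
Proof.
congr pair; last exact: bact_one.
by apply/ffunP => v; rewrite !ffunE.
Qed.

Lemma wreath_actM p q r :
  wreath_act (p * q) r = wreath_act p (wreath_act q r).
Proof.
congr pair; last exact: bactM.
by apply/ffunP => v; rewrite !ffunE mulgA.
Qed.

Lemma wreath_actD p q r : wreath_act p (q * r)
  = wreath_act p q * wreath_act ((wreath_act p q)^-1 * p * q) r.
Proof.
congr pair; last exact: bactD.
apply/ffunP => v; rewrite !ffunE /=; congr (_ * r.1 _).
by rewrite -!mulgA mulKVg.
Qed.

Definition wreath_braiding : braiding wreath :=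
  Braiding wreath_act1 wreath_act_one wreath_actM wreath_actD.

Lemma wreath_snd_morphism :
  sol_morphism (bsol wreath_braiding) (bsol c) (fun p => p.2).
Proof. by []. Qed.
End Wreath.

Section WreathEval.
Variables (K B : finGroupType) (c : braiding B) (V : Type) (b : V -> wreath K B).

Local Notation SW := (bsol (wreath_braiding K c)).

Definition base_eval (w : word V) : B :=
  word_val (eval (bsol c) (fun y => (b y).2)) w.

Definition letter_val (v : B) (a : letter V) : K :=
  let k := (b a.2).1 (v * base_eval a.1.2) in if a.1.1 then k^-1 else k.

Definition letters_val (v : B) (l : seq (letter V)) : K :=
  \prod_(a <- l) letter_val v a.

Lemma letters_val_cat v l1 l2 :
  letters_val v (l1 ++ l2) = letters_val v l1 * letters_val v l2.
Proof. exact: big_cat. Qed.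

Lemma letters_val_act u v l :
  letters_val v (act_letters u l) = letters_val (v * base_eval u) l.
Proof.
rewrite /letters_val big_map; apply: eq_bigr => a _.
by rewrite /letter_val /base_eval /= mulgA.
Qed.

Lemma letters_val_opp v l : letters_val v (opp_letters l) = (letters_val v l)^-1.
Proof.
elim: l => [|a l IHl]; first by rewrite /letters_val !big_nil invg1.
rewrite /opp_letters /= rev_cons -cats1 letters_val_cat -/(opp_letters l) IHl.
rewrite /letters_val big_seq1 big_cons invMg; congr (_ * _).
by rewrite /letter_val /=; case: a.1.1; rewrite /= ?invgK.
Qed.

Lemma eval_wreath2 t : (eval SW b t).2 = base_eval (Gen t).
Proof. exact: (morph_eval (@wreath_snd_morphism K B c) b t). Qed.

Lemma word_val_wreath2 w : (word_val (eval SW b) w).2 = base_eval w.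
Proof.
elim: w => [t||u IHu w IHw|u IHu] //; first exact: eval_wreath2.
  by rewrite /base_eval /= -/(base_eval u) -/(base_eval w) -IHu -IHw.
by rewrite /base_eval /= -/(base_eval u) -IHu.
Qed.

Lemma eval_wreath1 t v : (eval SW b t).1 v = letters_val v (term_letters t).
Proof.
elim: t v => [y|s IHs t IHt|s IHs t IHt|s IHs t IHt|s IHs t IHt] v.
- by rewrite /letters_val big_seq1 /letter_val /base_eval /= mulg1.
- by rewrite -[eval _ _ _]/(wreath_act c (eval SW b s) _) ffunE letters_val_act
    -eval_wreath2 IHt.
- rewrite -[eval _ _ _]/(brho (wreath_braiding K c) (eval SW b t) (eval SW b s)).
  rewrite [term_letters _]/= /brho letters_val_act !letters_val_cat letters_val_opp.
  rewrite letters_val_act -IHs -IHt -mulgA.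
  set x := eval SW b s; set y := eval SW b t; set u := wreath_braiding K c x y.
  have u2 : u.2 = base_eval (Gen (Lam s t)) by rewrite -eval_wreath2.
  rewrite !(wreathM1, wreathV1, wreathV2) u2; set v' := v * base_eval _.
  by rewrite /u ffunE -/x -eval_wreath2 -/x.
- rewrite -[eval _ _ _]/(lamV SW (eval SW b s) (eval SW b t)) lamV_bsol.
  by rewrite ffunE letters_val_act wreathV2 eval_wreath2 IHt.
rewrite [RHS]/= !letters_val_cat letters_val_opp !letters_val_act -IHs -IHt.
rewrite -[eval _ _ (RhoV s t)]/(rhoV SW (eval SW b t) (eval SW b s)).
set x := eval SW b s; set y := eval SW b t; set w := rhoV SW y x.
have w2 : base_eval (Gen (RhoV s t)) = w.2 by rewrite -eval_wreath2.
have x2 : base_eval (Gen s) = x.2 by rewrite -eval_wreath2.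
have y2 : base_eval (Gen t) = y.2 by rewrite -eval_wreath2.
have -> : base_eval (GMul (GMul (Gen (RhoV s t)) (Gen t)) (GInv (Gen s)))
          = w.2 * y.2 * x.2^-1 by rewrite -w2 -x2 -y2.
set u := wreath_braiding K c w y.
have rw : brho (wreath_braiding K c) y w = x := rhoVK SW y x.
have ux : u * x = w * y by rewrite -rw bact_rho.
have u2 : w.2 * y.2 * x.2^-1 = u.2 by rewrite -wreathM2 -ux wreathM2 mulgK.
(* With [x] solved from [u * x = w * y] the product telescopes to [w.1 v], because [u.1 v] is
   [y.1 (v * w.2)]. *)
rewrite w2 u2; have -> : x = u^-1 * (w * y) by rewrite -ux mulKg.
rewrite !(wreathM1, wreathV1, wreathV2) -!mulgA mulgV mulg1.
by rewrite /u ffunE !mulKVg mulgV mulg1.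
Qed.

Lemma word_val_wreath1 w v :
  (word_val (eval SW b) w).1 v = letters_val v (letters w).
Proof.
elim: w v => [t||u IHu w IHw|u IHu] v.
- exact: eval_wreath1.
- by rewrite /letters_val big_nil ffunE.
- by rewrite /= wreathM1 letters_val_cat letters_val_act IHu IHw word_val_wreath2.
rewrite /= wreathV1 letters_val_act letters_val_opp IHu.
by rewrite word_val_wreath2.
Qed.
End WreathEval.

(** * Separation of words *)

Section Separation.
Variables (X : Type) (S : solution X) (V : Type) (e : V -> X).
Hypothesis dS : diag_invertible S.
Variable L : seq {classic (word V)}.

Definition letter_words : seq {classic (word V)} :=
  flatten [seq [seq a.1.2 : {classic (word V)} | a <- letters w] | w <- L].

Definition points : seq (sgroup S) :=
  1 :: flatten [seq scanl (@walk_step _ S _ e) 1 (letters w) | w <- L].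

Variables (B : finGroupType) (c : braiding B) (b : V -> B).

Hypothesis b_sep : forall g g', g \in letter_words -> g' \in letter_words ->
  word_val (eval (bsol c) b) g = word_val (eval (bsol c) b) g' ->
  sgact (sg_eval S e g) =1 sgact (sg_eval S e g').

(* M. Hall's argument: the bijections [sg_add] restrict to partial injections of
   the finite set [points], which extend to permutations. *)
Lemma generator_perm (v : B) (y : V) : {p : {perm seq_sub points} |
  forall g, g \in letter_words -> word_val (eval (bsol c) b) g = v ->
  forall d d', sg_add (sgact (sg_eval S e g) (e y)) (val d) = val d' -> p d = d'}.
Proof.
apply: cid.
(* If no acting word has value [v], any permutation will do; otherwise [b_sep] makes the bijection
   independent of the chosen [g]. *)
have [[g [gL gv]]|nog] := pselect (exists g, g \in letter_words /\
    word_val (eval (bsol c) b) g = v); last first.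
  by exists 1 => g gL gv; case: nog; exists g.
have [p pP] := @perm_extension _ points
  (sg_add (sgact (sg_eval S e g) (e y))) (can_inj (sg_addK _ dS)).
exists p => g' g'L g'v d d'; rewrite -(b_sep gL g'L) ?gv //; exact: pP.
Qed.

Definition wreath_lift (y : V) : wreath {perm seq_sub points} B :=
  ([ffun v => sval (generator_perm v y)], b y).

(** Products of permutations act from left to right, so the letter values carry [d] along the walk
    in its order. *)
Lemma wreath_lift_walk l (d : seq_sub points) :
    all (fun a : letter V => (a.1.2 : {classic (word V)}) \in letter_words) l ->
    {subset scanl (@walk_step _ S _ e) (val d) l <= points} ->
  val (letters_val c wreath_lift 1 l d) = walk e (val d) l.
Proof.
elim: l d => [|a l IHl] d /=.
  by rewrite /letters_val big_nil perm1.
case/andP=> aL lL sub_pts.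
have d'P : walk_step e (val d) a \in points by apply: sub_pts; rewrite mem_head.
rewrite /letters_val big_cons permM -/(letters_val _ _ _ _).
suff -> : letter_val c wreath_lift 1 a d = SeqSub d'P.
  by rewrite IHl // => h hl; apply: sub_pts; rewrite inE hl orbT.
rewrite /letter_val /= ffunE mul1g.
case: generator_perm => p /= /(_ _ aL erefl) pP.
case Da: a.1.1; last by apply: pP; rewrite /= /walk_step Da.
(* A negative letter runs through an arrow of the permutation backwards. *)
apply: (canLR (permK p)); apply/esym/pP.
by rewrite /= /walk_step Da sg_subK.
Qed.

Lemma wreath_lift_separates w w' : w \in L -> w' \in L ->
    let c' := wreath_braiding {perm seq_sub points} c in
    word_val (eval (bsol c') wreath_lift) w
    = word_val (eval (bsol c') wreath_lift) w' ->
  sg_eval S e w = sg_eval S e w'.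
Proof.
have pts1 : 1 \in points by rewrite mem_head.
have walkP u : u \in L ->
    sg_eval S e u = val (letters_val c wreath_lift 1 (letters u) (SeqSub pts1)).
  move=> uL; rewrite wreath_lift_walk ?walk_letters //; last first.
    move=> h hu; rewrite inE; apply/orP; right; apply/flattenP.
    exists (scanl (@walk_step _ S _ e) 1 (letters u)) => //.
    exact: (map_f (fun u : {classic (word V)} =>
      scanl (@walk_step _ S _ e) 1 (letters u))).
  rewrite -(all_map (fun a : letter V => (a.1.2 : {classic (word V)}))
    (fun g => g \in letter_words)).
  apply/allP => g gu; apply/flattenP.
  exists [seq (a.1.2 : {classic (word V)}) | a <- letters u] => //.
  exact: (map_f (fun u : {classic (word V)} =>
    [seq (a.1.2 : {classic (word V)}) | a <- letters u])).
move=> wL w'L c' Eww'; rewrite (walkP w wL) (walkP w' w'L).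
by rewrite -!word_val_wreath1 Eww'.
Qed.
End Separation.

(** * The induction on the nilpotency class *)

Lemma eq_word_act (T X : Type) (L LV L' LV' : T -> X -> X) w :
    (forall t, L t =1 L' t) -> (forall t, LV t =1 LV' t) ->
  (word_act L LV w).1 =1 (word_act L' LV' w).1 /\
  (word_act L LV w).2 =1 (word_act L' LV' w).2.
Proof.
move=> EL ELV; elim: w => [t||u [u1 u2] w [w1 w2]|u [u1 u2]] //=.
by split=> x /=; rewrite ?w1 ?u1 ?w2 ?u2.
Qed.

Section Quotient.
Variables (X : Type) (S : solution X) (dS : diag_invertible S).

Local Notation S' := (sim_solution dS).

Lemma sim_diag : diag_invertible S'.
Proof.
have [codiagK diagK] : diag_invertible S by [].
have piM := sim_pi_morphism dS.
have diagE x : diag S' (sim_pi S x) = sim_pi S (diag S x).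
  by rewrite /diag (morph_lamV piM).
have codiagE x : codiag S' (sim_pi S x) = sim_pi S (codiag S x).
  by rewrite /codiag (morph_rhoV piM).
by split=> a; rewrite -[a]sim_reprK !(diagE, codiagE) ?codiagK ?diagK.
Qed.

Lemma sim_RNS n : 0 < n -> RNS S n.+1 -> RNS S' n.
Proof.
apply: (RNS_push (sim_pi_morphism dS) (@sim_reprK _ S)) => x y sxy.
by apply/sim_piP => m Wm; apply: (sxy (exist _ m Wm)).
Qed.

(** Since [lam S x] depends only on the class of [x], the structure group of the quotient acts on
    [X] through representatives, and a word acts through its value there. *)
Lemma sim_sg_eval (V : Type) (e : V -> X) g g' :
    sg_eval S' (sim_pi S \o e) g = sg_eval S' (sim_pi S \o e) g' ->
  sgact (sg_eval S e g) =1 sgact (sg_eval S e g').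
Proof.
pose L (a : sim_quot S) := lam S (sim_repr a).
pose LV (a : sim_quot S) := lamV S (sim_repr a).
have lam_repr x : lam S (sim_repr (sim_pi S x)) =1 lam S x.
  exact/sim_lam_eq/sim_pi_repr.
have act_pi w : sgact (sg_eval S e w)
    =1 (word_act L LV (word_map (eval S' (sim_pi S \o e)) w)).1.
  move=> x; rewrite sgact_word_val word_act_map.
  apply: (eq_word_act w _ _).1 => t z /=;
    rewrite -(morph_eval (sim_pi_morphism dS)) /L /LV /=.
    by rewrite lam_repr.
  by apply: lam_lamV_eq => y; rewrite lam_repr.
move/word_val_gen/(word_act_sg_eq (L := L) (LV := LV)) => eq_act x.
rewrite !act_pi; apply: eq_act => [a|a|a b z].
- exact: lamK.
- exact: lamVK.
by rewrite /L lam_lam !lam_repr.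
Qed.
End Quotient.

Lemma finite_separation n (V : Type) (X : Type) (S : solution X) (e : V -> X)
    (L : seq {classic (word V)}) :
    diag_invertible S -> 0 < n -> RNS S n ->
  exists (B : finGroupType) (c : braiding B) (b : V -> B), RNS (bsol c) n /\
    forall w w', w \in L -> w' \in L ->
      word_val (eval (bsol c) b) w = word_val (eval (bsol c) b) w' ->
      sg_eval S e w = sg_eval S e w'.
Proof.
move=> dS n_gt0; elim: n n_gt0 X S dS e L => // -[|n] IHn _ X S dS e L nilS.
  (* In class 1 all words act as the identity, so the trivial group separates their actions. *)
  pose B : finGroupType := {perm void}.
  have triv (x y : B) : x = y by apply/permP => -[].
  have c : braiding B by exists (fun x y => y) => *; apply: triv.
  have act_id k : sgact (sg_eval S e k) =1 id.
    have lamV1 x : lamV S x =1 id.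
      by move=> z; apply: (can_inj (lamK S x)); rewrite lamVK nilS.
    move=> x; rewrite sgact_word_val.
    have [-> _] := @eq_word_act _ _ _ _ (fun=> id) (fun=> id) k
      (fun t => nilS (eval S e t)) (fun t => lamV1 (eval S e t)).
    suff -> : word_act (fun=> @id X) (fun=> id) k = (id, id) by [].
    by elim: k => //= [u -> w ->|u ->].
  pose b (_ : V) : B := 1.
  have b_sep g g' : g \in letter_words L -> g' \in letter_words L ->
      word_val (eval (bsol c) b) g = word_val (eval (bsol c) b) g' ->
      sgact (sg_eval S e g) =1 sgact (sg_eval S e g').
    by move=> _ _ _ x; rewrite !act_id.
  exists (wreath {perm seq_sub (points S e L)} B), (wreath_braiding _ c).
  exists (wreath_lift dS b_sep); split; last exact: wreath_lift_separates.
  (* As [B] is trivial, so are translation on it and the action on the wreath product. *)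
  move=> p [f z]; congr pair; last exact: triv.
  by apply/ffunP => v; rewrite ffunE (triv (v * _) v).
have [B [c [b [nilB sepB]]]] := IHn isT _ _ (sim_diag dS) (sim_pi S \o e)
  (letter_words L) (sim_RNS dS (ltn0Sn n) nilS).
have b_sep g g' : g \in letter_words L -> g' \in letter_words L ->
    word_val (eval (bsol c) b) g = word_val (eval (bsol c) b) g' ->
    sgact (sg_eval S e g) =1 sgact (sg_eval S e g').
  by move=> gL g'L /(sepB _ _ gL g'L); apply: sim_sg_eval.
exists (wreath {perm seq_sub (points S e L)} B), (wreath_braiding _ c).
exists (wreath_lift dS b_sep); split; last exact: wreath_lift_separates.
(* The action on the wreath product depends only on the second component of the acting element, so
   the class exceeds that of [B] by at most one. *)
apply: (RNS_pull (@wreath_snd_morphism _ _ c)) nilB => // p q Epq r.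
congr pair; last by rewrite Epq.
by apply/ffunP => v; rewrite !ffunE Epq.
Qed.

Theorem theoremD (n : nat) (n_gt0 : 0 < n) (V : Type) (p q : term V)
  (Hfin : forall (X : finType) (S : solution X),
      injective_solution S -> RNS S n -> holds_in S p q) :
  (forall (X : Type) (S : solution X),
      injective_solution S -> RNS S n -> holds_in S p q) /\
  (forall (Y : Type), inhabited Y ->
   forall (F : Type) (S : solution F) (i : Y -> F),
      is_free_injective_RNS n S i -> holds_in S p q).
Proof.
have main (X : Type) (S : solution X) :
    injective_solution S -> RNS S n -> holds_in S p q.
  (* Injectivity turns the identity into an equality of two generators of the structure group, that
     is, of the values of two words. *)
  move=> injS nilS e; apply: (injective_gen injS).
  pose L : seq {classic (word V)} := [:: Gen p; Gen q].
  have [B [c [b [nilB sepB]]]] :=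
    finite_separation e L (injective_diag injS) n_gt0 nilS.
  apply: (sepB (Gen p) (Gen q)); rewrite ?inE ?eqxx ?orbT //=.
  exact: (Hfin _ _ (@bsol_injective _ c) nilB b).
by split=> // Y _ F S i [injS nilS _]; apply: main.
Qed.
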